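(* Let $G$ be a nontrivial finite group. Then $\operatorname{rdim}(G)=\sqrt{|G|}$ if and only if one of the following holds: (i) $G$ is a $2$-group with socle $\operatorname{Soc}(G)=Z(G)\cong C_2\times C_2$, and all characters in $\operatorname{Irr}(G|Z(G))$ are fully ramified with respect to $G/Z(G)$; (ii) $G$ is a $2$-group with socle $\operatorname{Soc}(G)=Z(G)\cong C_2\times C_2\times C_2\times C_2$, and all characters in $\operatorname{Irr}(G|Z(G))$ are fully ramified with respect to $G/Z(G)$.
   Context: For a finite group $G$, $\operatorname{rdim}(G)$ (the representation dimension of $G$) is the smallest integer $n$ such that $G$ embeds into $\operatorname{GL}(n,\mathbb{C})$. $Z(G)$ is the center of $G$, $\operatorname{Soc}(G)$ is the subgroup generated by all minimal normal subgroups of $G$, and $C_m$ is the cyclic group of order $m$. $\operatorname{Irr}(G)$ is the set of irreducible complex characters of $G$; $\operatorname{Irr}(G|Z(G))$ is the set of those $\chi\in\operatorname{Irr}(G)$ that lie over a nonprincipal linear character of $Z(G)$ (equivalently, $Z(G)\not\leq\operatorname{Ker}\chi$). If $N\trianglelefteq G$, $\chi\in\operatorname{Irr}(G)$ and $\theta\in\operatorname{Irr}(N)$ is a constituent of $\chi_N$, then $\chi$ is fully ramified with respect to $G/N$ if $\chi_N=e\theta$ with $e^2=|G:N|$ (so for $N=Z(G)$ this means $\chi(1)^2=|G:Z(G)|$). *)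

(* Defs.v *)
From mathcomp Require Import all_boot all_order all_fingroup all_algebra.
From mathcomp Require Import all_solvable all_field all_character.
From mathcomp Require Import boolp.

Set Implicit Arguments.
Unset Strict Implicit.
Unset Printing Implicit Defensive.

Import GroupScope GRing.Theory.

Local Open Scope ring_scope.
Local Open Scope group_scope.

Section Definitions.

Variable gT : finGroupType.
Implicit Types G N : {group gT}.

(* An embedding of G into GL(n, C) is a faithful matrix representation of      *)
(* degree n. The complex field is algC, as everywhere in the character library. *)
Definition embeds_GL G (n : nat) : Prop :=
  exists rG : mx_representation algC G n, mx_faithful rG.

Lemma ex_embeds_GL G : exists n, `[< embeds_GL G n >].
Proof.
by exists #|G|; apply/asboolP; exists (regular_repr algC G); exact: regular_mx_faithful.
Qed.

Definition rdim G : nat := ex_minn (ex_embeds_GL G).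

(* minnormal M G does not by itself entail M \subset G. *)
Definition Soc G : {set gT} :=
  <<\bigcup_(M : {group gT} | (M <| G) && minnormal M G) M>>.

Definition lies_over G N (i : Iirr G) (j : Iirr N) : bool :=
  (j \in irr_constt ('Res[N] 'chi_i))%R.

(* Irr(G | Z(G)), as a predicate on the indices of irr G; 'chi_0 is the        *)
(* principal character.                                                        *)
Definition Irr_center G (i : Iirr G) : Prop :=
  exists j : Iirr 'Z(G),
    [/\ 'chi_j \is a linear_char, (j != 0)%R & lies_over i j].

Definition fully_ramified G N (i : Iirr G) : Prop :=
  exists2 j : Iirr N, lies_over i j &
  exists2 e : nat, 'Res[N] 'chi_i = ('chi_j *+ e)%R & (e ^ 2)%N = #|G : N|.

End Definitions.

(* Main.v *)
(* Choose a set A of irreducible characters with trivial joint kernel and least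
   total degree, which is then rdim G. For i in A let K_i be the intersection of
   the kernels of the other members of A; it is nontrivial, and any nontrivial
   normal subgroups N_i <= K_i of G generate their direct product, of order P say.
   The
   irreducible characters of G trivial on all N_j (j != i) but not on N_i have
   degrees whose squares sum to |G|(|N_i| - 1)/P, so that
   deg i <= sqrt(|G|) sqrt((|N_i| - 1)/P). If the degrees sum to sqrt(|G|), an
   elementary inequality forces |K_i| = 2 for all i and |A| in {2, 3, 4}.

   Now every character nontrivial on K_i can replace i, hence has degree at least
   deg i. If |A| = 3, the squares above sum to |G|/8, which is not a square, so
   there are at least two such characters and 4 deg i <= sqrt(|G|), a
   contradiction. If |A| is 2 or 4, then deg i ^ 2 = |G|/2^|A| for all i in A, and
   deg i ^ 2 <= |G : Z(G)| makes Z(G) the product of the K_i. A character of degree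
   sqrt(|G : Z(G)|) vanishes off Z(G), so its restriction to a Sylow q-subgroup, q
   odd, is a multiple of the regular character; thus G is a 2-group.

   Conversely, under full ramification every member of A has degree
   sqrt(|G : Z(G)|), and comparing with the rank of Z(G) shows that |A| is this
   rank. *)
Require Import Defs.
From mathcomp Require Import all_boot all_order all_fingroup all_algebra.
From mathcomp Require Import all_solvable all_field all_character.
From mathcomp Require Import boolp zify.
Set Implicit Arguments.
Unset Strict Implicit.
Unset Printing Implicit Defensive.

(** * An elementary inequality for sums of square roots *)

(** Bounding [x] and [y] by square roots leaves the gap [(u + 1)(v + 1) - (sqrt u + sqrt v)^2 =
    (sqrt (u v) - 1)^2], positive since [u v > 1]. *)
Lemma two_term_bound (m P u v x y : nat) :
  0 < m -> 1 < u * v -> x ^ 2 * P <= m * u -> y ^ 2 * P <= m * v ->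
  (x + y) ^ 2 * P < m * (u.+1 * v.+1).
Proof.
move=> m_gt0 uv_gt1 le_x le_y.
have le_xy : (x * y * P) ^ 2 <= m ^ 2 * (u * v) by have := leq_mul le_x le_y; nia.
have lt_xy : 2 * (x * y * P) < m * (u * v).+1.
  rewrite -ltn_sqr !expnMn; apply: (@leq_ltn_trans (m ^ 2 * (4 * (u * v)))); first by nia.
  by rewrite ltn_pmul2l ?expn_gt0 ?m_gt0 //; move: (u * v) uv_gt1 => q; nia.
nia.
Qed.

(** Induction step for appending a term: [(sqrt Q + sqrt v)^2 <= Q (v + 1)] for all [v >= 1] once
    [sqrt Q >= 1 + sqrt 2], that is [Q >= 6] for integers. *)
Lemma next_term_bound (m P Q v x y : nat) :
  5 < Q -> 0 < v -> x ^ 2 * P < m * Q -> y ^ 2 * P <= m * v ->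
  (x + y) ^ 2 * P < m * (Q * v.+1).
Proof.
move=> Q_gt5 v_gt0 lt_x le_y.
(* AM-GM: [4 v x y <= v^2 x^2 + 4 y^2] *)
have amgm : 4 * v * (x * y) <= v ^ 2 * x ^ 2 + 4 * y ^ 2.
  have [] := nat_Cauchy (v * x) (2 * y); nia.
have amgmP : 4 * (x * y * P) <= v * (x ^ 2 * P) + 4 * m.
  by rewrite -(leq_pmul2l v_gt0); have := leq_mul amgm (leqnn P); nia.
have : m * ((v + 2) * (Q + 2)) <= m * (2 * (Q * v.+1)) by rewrite leq_mul2l; nia.
have : (v + 2) * (x ^ 2 * P) < (v + 2) * (m * Q) by rewrite ltn_pmul2l // addn2.
have -> : (x + y) ^ 2 * P = x ^ 2 * P + y ^ 2 * P + 2 * (x * y * P) by nia.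
move: (x ^ 2 * P) (y ^ 2 * P) (x * y * P) lt_x le_y amgmP => X Y W.
nia.
Qed.

Lemma sqrt_sum_bound (I : finType) (A : {set I}) (d n : I -> nat) (s : nat) :
    0 < s -> (forall i, i \in A -> 1 < n i) ->
    (forall i, i \in A ->
       d i ^ 2 * \prod_(j in A) n j <= s ^ 2 * (n i).-1) ->
    s <= \sum_(i in A) d i ->
  (forall i, i \in A -> n i = 2) /\ 1 < #|A| < 5.
Proof.
move=> s_gt0 n_gt1; set P := \prod_(j in A) n j => dP le_s.
have m_gt0 : 0 < s ^ 2 by rewrite expn_gt0 s_gt0.
have n2 i : i \in A -> n i = 2.
  move=> Ai; apply/eqP; rewrite eqn_leq n_gt1 // andbT leqNgt; apply/negP=> n_gt2.
  (* In terms of x_j = sqrt (n_j - 1), this is (x_i + sum x_j)^2 < (x_i^2 + 1) prod (x_j^2 + 1):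
     it fails if all the n_j are 2, hence the induction starts from i. *)
  have bound (r : seq I) : {subset r <= A} -> r != [::] ->
     (d i + \sum_(j <- r) d j) ^ 2 * P < s ^ 2 * (n i * \prod_(j <- r) n j).
    elim: r => // k [|l r] IHr sA _.
      have Ak : k \in A by apply: sA; rewrite inE.
      rewrite !big_seq1 -(prednK (ltnW (n_gt1 _ Ai))) -(prednK (ltnW (n_gt1 _ Ak))).
      apply: two_term_bound; rewrite ?dP //.
      by have := n_gt1 k Ak; nia.
    have Ak : k \in A by apply: sA; rewrite inE eqxx.
    have sA' : {subset l :: r <= A} by move=> z rz; apply: sA; rewrite inE rz orbT.
    have {}IHr := IHr sA' isT; rewrite !(big_cons _ _ k).
    (* The threshold 6 is [3 * 2]: [n i > 2] and one further factor. *)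
    have Q_gt5 : 5 < n i * \prod_(j <- l :: r) n j.
      rewrite big_cons mulnA -[6]/(3 * 2 * 1) !leq_mul ?n_gt1 ?sA' ?mem_head //.
      by rewrite big_seq prodn_cond_gt0 // => j rj; rewrite ltnW ?n_gt1 ?sA' // inE rj orbT.
    have := next_term_bound Q_gt5 _ IHr (dP k Ak).
    rewrite prednK ?(ltnW (n_gt1 _ Ak)) // -subn1 subn_gt0 n_gt1 // => /(_ isT).
    by rewrite addnAC -addnA mulnAC -mulnA.
  have sumA (F : I -> nat) : \sum_(j in A) F j = F i + \sum_(j <- enum (A :\ i)) F j.
    by rewrite (big_setD1 i Ai) /= big_enum.
  have defP : P = n i * \prod_(j <- enum (A :\ i)) n j.
    by rewrite /P (big_setD1 i Ai) /= big_enum.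
  have : s ^ 2 * P <= (\sum_(j in A) d j) ^ 2 * P by rewrite leq_mul2r leq_sqr le_s orbT.
  rewrite sumA leqNgt => /negP[]; have [Ei | nEi] := eqVneq (enum (A :\ i)) [::].
    rewrite Ei big_nil addn0; apply: leq_ltn_trans (dP i Ai) _.
    rewrite ltn_pmul2l // defP Ei big_nil muln1 prednK //; exact: ltnW (n_gt1 i Ai).
  rewrite [X in _ < _ * X]defP; apply: bound => // j.
  by rewrite mem_enum => /setD1P[].
split=> //; have defP : P = 2 ^ #|A|.
  by rewrite /P (eq_bigr (fun=> 2) n2) prod_nat_const.
have [i Ai max_i] : exists2 i, i \in A & forall j, j \in A -> d j <= d i.
  have [i0 Ai0] : exists i, i \in A.
    apply/set0Pn; apply: contraTneq le_s => ->; rewrite big_set0 -ltnNge //.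
  by case: (arg_maxnP d Ai0) => i Ai max_i; exists i.
have le_si : s <= #|A| * d i.
  by apply: leq_trans le_s _; rewrite -sum_nat_const leq_sum.
have := dP i Ai; rewrite n2 // muln1 defP => le_d.
(* Each term is at most [s / sqrt (2 ^ #|A|)]. The inequality [2 ^ c <= c ^ 2] holds only for
   [c = 2, 3, 4]. *)
have : 2 ^ #|A| <= #|A| ^ 2.
  rewrite -(leq_pmul2l m_gt0); apply: leq_trans (_ : (#|A| * d i) ^ 2 * 2 ^ #|A| <= _).
    by rewrite leq_mul2r leq_sqr le_si orbT.
  by rewrite expnMn -mulnA mulnC leq_mul2r le_d orbT.
case: #|A| => [|[|[|[|[|c]]]]] //; rewrite leqNgt => /negP[].
elim: c => // c; rewrite [2 ^ c.+1.+1.+4]expnS; move: (2 ^ _) => q; nia.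
Qed.

Import GroupScope Order.TTheory GRing.Theory Num.Theory.

(** * Faithful sets of irreducible characters *)

Section FaithfulSets.
Local Open Scope ring_scope.
Local Open Scope group_scope.
Local Open Scope nat_scope.
Variables (gT : finGroupType) (G : {group gT}).
Implicit Types (i j : Iirr G) (A : {set Iirr G}).

Definition deg i : nat := irr_degree (socle_of_Iirr i).

(** Intersecting with [G] matters for empty [A], where the big intersection is all of [gT]. *)
Definition joint_ker A : {set gT} := G :&: \bigcap_(i in A) cfker 'chi_i.
Canonical joint_ker_group A := Eval hnf in [group of joint_ker A].

Lemma deg_gt0 i : 0 < deg i. Proof. exact: irr_degree_gt0. Qed.

Lemma joint_ker_normal A : joint_ker A <| G.
Proof.
rewrite /normal subsetIl normsI ?normG //.
by apply: norms_bigcap; apply/bigcapsP=> i _; apply: cfker_norm.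
Qed.

Lemma joint_kerU1 i A : joint_ker (i |: A) = joint_ker A :&: cfker 'chi_i.
Proof.
rewrite /joint_ker -setIA; congr (_ :&: _).
apply/setP=> x; rewrite in_setI; apply/bigcapP/andP=> [Kx | [/bigcapP Kx kx] j].
  by split; [apply/bigcapP=> j Aj; apply: Kx; apply: setU1r | apply: Kx; apply: setU11].
by case/setU1P=> [-> // | /Kx].
Qed.

Lemma rdim_le A : joint_ker A \subset [1] -> rdim G <= \sum_(i in A) deg i.
Proof.
move=> kA; rewrite /rdim; case: ex_minnP => n _; apply; apply/asboolP.
have Nphi : (\sum_(i in A) 'chi_i)%R \is a character.
  by apply: rpred_sum => i _; apply: irr_char.
have [[m rG] /= Dphi] := char_reprP Nphi.
have <-: m = \sum_(i in A) deg i.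
  apply/eqP; rewrite -(eqr_nat algC) -(cfRepr1 rG) -Dphi sum_cfunE natr_sum.
  by apply/eqP; apply: eq_bigr => i _; rewrite irr1_degree.
exists rG; rewrite /mx_faithful -cfker_repr -Dphi; apply: subset_trans kA.
rewrite cfkerE // subsetI subsetIl /=; apply/bigcapsP=> i Ai.
rewrite subIset // (bigcap_min i) ?orbT // irr_consttE cfdot_suml (bigD1 i) //=.
rewrite cfnorm_irr big1 ?addr0 ?oner_eq0 // => j /andP[_ /negPf ne_ji].
by rewrite cfdot_irr ne_ji.
Qed.

(** Dropping repeated constituents of a faithful character does not change its kernel. *)
Lemma rdim_attained :
  exists2 A, joint_ker A \subset [1] & \sum_(i in A) deg i = rdim G.
Proof.
have [rG faithG] : embeds_GL G (rdim G).
  by rewrite /rdim; case: ex_minnP => n /asboolP.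
pose phi := cfRepr rG; have Nphi : phi \is a character := cfRepr_char rG.
pose A := [set i in irr_constt phi].
have kA : joint_ker A \subset [1].
  apply: subset_trans faithG; rewrite -cfker_repr cfkerE //.
  rewrite setIS //; apply/bigcapsP=> i phi_i.
  by rewrite (bigcap_min i) // inE.
exists A => //; apply/eqP; rewrite eqn_leq (rdim_le kA) andbT.
rewrite -(ler_nat algC) -(cfRepr1 rG) -/phi [phi in leRHS]cfun_sum_constt sum_cfunE.
rewrite natr_sum (eq_bigl (mem (irr_constt phi))); last by move=> i; rewrite inE.
apply: ler_sum => i phi_i; rewrite cfunE -irr1_degree.
have /natrP[k Dk] := Cnat_cfdot_char_irr i Nphi.
have: i \in irr_constt phi by []; rewrite irr_consttE Dk pnatr_eq0 -lt0n => k_gt0.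
by rewrite ler_peMl ?ler1n // ltW ?irr1_gt0.
Qed.

(** * Sums of squared degrees *)

Lemma sum_deg_sq_ker (C : {group gT}) : C <| G ->
  \sum_(i : Iirr G | C \subset cfker 'chi_i) deg i ^ 2 = #|G : C|.
Proof.
move=> nCG; apply/eqP; rewrite -(eqr_nat algC) -(card_quotient (normal_norm nCG)).
have norm_sq (hT : finGroupType) (H : {group hT}) (i : Iirr H) :
    (`|'chi_i 1%g| ^+ 2 = 'chi_i 1%g ^+ 2)%R.
  by rewrite irr1_degree normr_nat.
rewrite natr_sum -irr_sum_square; apply/eqP.
under [RHS]eq_bigr => i _ do rewrite -norm_sq.
rewrite -(morph1 (coset C)) (sum_norm_irr_quo (group1 G) nCG).
by apply: eq_bigr => i _; rewrite norm_sq irr1_degree natrX.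
Qed.

Lemma sum_deg_sq_diff (C E : {group gT}) : C <| G -> E <| G -> C \subset E ->
  \sum_(i : Iirr G | (C \subset cfker 'chi_i) && ~~ (E \subset cfker 'chi_i))
     deg i ^ 2 + #|G : E| = #|G : C|.
Proof.
move=> nCG nEG sCE; rewrite -(sum_deg_sq_ker nCG) -(sum_deg_sq_ker nEG).
rewrite [RHS](bigID (fun i => E \subset cfker 'chi_i)) /= addnC; congr (_ + _).
apply: eq_bigl => i; rewrite andb_idl //; exact: subset_trans.
Qed.

Lemma joint_ker_sub i A : i \in A -> joint_ker A \subset cfker 'chi_i.
Proof. by move=> Ai; rewrite subIset // (bigcap_inf i) ?orbT. Qed.

Lemma joint_kerD1I i A : i \in A ->
  joint_ker (A :\ i) :&: cfker 'chi_i = joint_ker A.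
Proof. by move=> Ai; rewrite -joint_kerU1 setD1K. Qed.

(** * Independent normal subgroups *)

Section Independence.

Variables (A : {set Iirr G}) (N : Iirr G -> {group gT}).
Hypothesis faithA : joint_ker A \subset [1].
Hypothesis nsNG : forall i, i \in A -> N i <| G.
Hypothesis sNK : forall i, i \in A -> N i \subset joint_ker (A :\ i).

Lemma TI_cfker_indep i : i \in A -> N i :&: cfker 'chi_i = [1].
Proof.
move=> Ai; apply/trivgP; apply: subset_trans faithA.
by rewrite -(joint_kerD1I Ai) setSI ?sNK.
Qed.

(** All [N j] with [j != i] lie in [cfker 'chi_i], which meets [N i] trivially; being normalized by
    each other, the two sides commute. *)
Lemma bigdprod_indep : \big[dprod/[1]]_(i in A) N i = (\prod_(i in A) N i)%G.
Proof.
apply/eqP/bigdprodYP => i Ai; set C := (\prod_(j in A | j != i) N j)%G.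
have sCk : C \subset cfker 'chi_i.
  rewrite /C bigprodGE gen_subG; apply/bigcupsP=> j /andP[Aj ne_ji].
  by apply: subset_trans (sNK Aj) _; rewrite joint_ker_sub // !inE eq_sym ne_ji.
have nCN : C \subset 'N(N i).
  by apply: subset_trans (normal_norm (nsNG Ai)); apply: subset_trans sCk (cfker_sub _).
have nNk : N i \subset 'N(cfker 'chi_i).
  exact: subset_trans (normal_sub (nsNG Ai)) (cfker_norm _).
have tiNC : N i :&: C = 1%g.
  by apply/trivgP; rewrite -(TI_cfker_indep Ai) setIS.
rewrite subsetD; apply/andP; split.
  rewrite centsC (sameP commG1P trivgP) -(TI_cfker_indep Ai).
  rewrite subsetI commg_subl nCN /=; apply: subset_trans (commgS _ sCk) _.
  by rewrite commg_subr.
rewrite -setI_eq0 -subset0; apply/subsetP=> x /setIP[Cx /setD1P[nt_x Nx]].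
by rewrite -in_set1 -[[set 1%g]]tiNC inE Nx Cx in nt_x.
Qed.

Lemma card_indep : #|(\prod_(i in A) N i)%G| = \prod_(i in A) #|N i|.
Proof. by rewrite -(bigdprod_card bigdprod_indep). Qed.

Lemma normal_indep : (\prod_(i in A) N i)%G <| G.
Proof.
rewrite bigprodGE /normal gen_subG norms_gen ?norms_bigcup ?andbT //.
  by apply/bigcupsP=> i Ai; apply: normal_sub; apply: nsNG.
by apply/bigcapsP=> i Ai; apply: normal_norm; apply: nsNG.
Qed.

Lemma indep_complement i : i \in A ->
  exists C : {group gT}, [/\ C <| G, C \subset cfker 'chi_i
    & N i \x C = (\prod_(i in A) N i)%G].
Proof.
move=> Ai; have := bigdprod_indep; rewrite (bigD1 i) //= => defE.
have [[_ C _ defC] _ _ _] := dprodP defE; rewrite defC in defE.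
exists C; split=> //.
  rewrite -(bigdprodWY defC) /normal gen_subG norms_gen ?norms_bigcup ?andbT //.
    by apply/bigcupsP=> j /andP[Aj _]; apply: normal_sub; apply: nsNG.
  by apply/bigcapsP=> j /andP[Aj _]; apply: normal_norm; apply: nsNG.
rewrite -(bigdprodWY defC) gen_subG; apply/bigcupsP=> j /andP[Aj ne_ji].
by apply: subset_trans (sNK Aj) _; rewrite joint_ker_sub // !inE eq_sym ne_ji.
Qed.

(* With E the product of all the N j and C that of the N j for j != i, the sum of
   squares is [#|G : C| - #|G : E|]; it is multiplied here by [#|E|]. *)
Lemma indep_sum_deg_sq i : i \in A -> exists C : {group gT},
  C \subset cfker 'chi_i /\
  (\sum_(j : Iirr G | (C \subset cfker 'chi_j) && ~~ (N i \subset cfker 'chi_j))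
     deg j ^ 2) * (\prod_(j in A) #|N j|) = #|G| * #|N i|.-1.
Proof.
move=> Ai; have [C [nsCG sCk defE]] := indep_complement Ai; exists C; split=> //.
move: defE card_indep normal_indep; set E := (\prod_(j in A) N j)%G.
move=> defE <- nsEG; have [_ defNC _ _] := dprodP defE.
have sCE : C \subset E by rewrite -defNC mulG_subr.
have oE : #|N i| * #|C| = #|E| := dprod_card defE.
have := sum_deg_sq_diff nsCG nsEG sCE; set S := \sum_(j | _) _ => oS.
rewrite (eq_bigl (fun j : Iirr G =>
  (C \subset cfker 'chi_j) && ~~ (E \subset cfker 'chi_j))).
  rewrite -/S; apply/eqP; rewrite -(eqn_add2r #|G|) -mulnSr prednK //.
  rewrite -{1}(Lagrange (normal_sub nsEG)) [#|E| * _]mulnC -mulnDl oS -oE.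
  by apply/eqP; rewrite -(Lagrange (normal_sub nsCG)) [LHS]mulnC -mulnA [RHS]mulnC.
move=> j; case sCj: (C \subset _) => //=; congr (~~ _).
by rewrite -defNC mulG_subG sCj andbT.
Qed.

(** ['chi_i] is itself a term of the sum of squares: its kernel contains [C] but not [N i]. *)
Lemma indep_deg_bound i : i \in A -> N i :!=: [1] ->
  deg i ^ 2 * \prod_(j in A) #|N j| <= #|G| * #|N i|.-1.
Proof.
move=> Ai ntN; have [C [sCk <-]] := indep_sum_deg_sq Ai.
rewrite leq_mul2r; apply/orP; right.
have nkN : ~~ (N i \subset cfker 'chi_i).
  by apply: contra ntN => sNk; rewrite -(TI_cfker_indep Ai) (setIidPl sNk).
by rewrite (bigD1 i) ?sCk //= leq_addr.
Qed.

End Independence.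

(** * Restriction to the center and full ramification *)

Lemma center_sub_cfcenter i : 'Z(G) \subset 'Z('chi_i)%CF.
Proof. by rewrite -cap_cfcenter_irr (bigcap_inf i). Qed.

Lemma deg_sq_center i : deg i ^ 2 <= #|G : 'Z(G)|.
Proof.
apply: leq_trans (_ : #|G : 'Z('chi_i)%CF| <= _).
  by have [] := irr1_bound i; rewrite irr1_degree -natrX ler_nat.
by rewrite dvdn_leq ?indexgS ?center_sub_cfcenter ?indexg_gt0 //.
Qed.

Lemma Res_center i : exists2 j : Iirr 'Z(G), 'chi_j \is a linear_char
  & ('Res['Z(G)] 'chi_i = 'chi_j *+ deg i)%R.
Proof.
have [mu lin_mu Dmu] := cfcenter_Res 'chi_i.
have lin_nu : 'Res['Z(G)] mu \is a linear_char by apply: cfRes_lin_char.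
have /irrP[j Dj] := lin_char_irr lin_nu; exists j; rewrite -Dj //.
rewrite -(cfResRes _ (center_sub_cfcenter i) (cfcenter_sub _)) Dmu linearZ /=.
by rewrite irr1_degree scaler_nat.
Qed.

Lemma Res_center_constt i (j k : Iirr 'Z(G)) :
  ('Res['Z(G)] 'chi_i = 'chi_j *+ deg i)%R -> lies_over i k = (k == j).
Proof.
move=> Dj; rewrite /lies_over Dj irr_consttE -scaler_nat cfdotZl cfdot_irr [j == k]eq_sym.
by case: (k == j); rewrite ?mulr0 ?eqxx // mulr1 pnatr_eq0 -lt0n deg_gt0.
Qed.

Lemma Irr_centerP i : Irr_center i <-> ~~ ('Z(G) \subset cfker 'chi_i).
Proof.
have [j lin_j Dj] := Res_center i; have Dk := Res_center_constt _ Dj.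
have kerE : ('Z(G) \subset cfker 'chi_i) = (j == 0)%R.
  apply/idP/eqP => [sZk | j0].
    apply: irr_inj; apply/cfun_inP => z Zz; rewrite irr0 cfun1E Zz.
    have : ('Res['Z(G)] 'chi_i z = 'chi_i 1%g)%R.
      by rewrite cfResE ?center_sub // cfker1 // (subsetP sZk).
    rewrite Dj irr1_degree -scaler_nat cfunE -[X in _ = X -> _]mulr1 => /mulfI-> //.
    by rewrite pnatr_eq0 -lt0n deg_gt0.
  apply/subsetP=> z Zz; rewrite cfkerEirr inE -!(cfResE _ (center_sub G)) //.
  by rewrite Dj j0 irr0 -scaler_nat !cfunE !cfun1E Zz group1.
rewrite kerE; split=> [[k [_ nz_k]] | nz_j]; first by rewrite Dk => /eqP <-.
by exists j; rewrite Dk eqxx.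
Qed.

Lemma fully_ramifiedP i :
  fully_ramified 'Z(G) i <-> deg i ^ 2 = #|G : 'Z(G)|.
Proof.
have [j lin_j Dj] := Res_center i; have Dk := Res_center_constt _ Dj.
split=> [[k] | sq_deg]; last by exists j; rewrite ?Dk //; exists (deg i).
rewrite Dk => /eqP-> [e De <-]; congr (_ ^ 2); apply/eqP; rewrite -(eqr_nat algC).
have := congr1 (fun phi : 'CF('Z(G)) => phi 1%g) De.
by rewrite Dj -!scaler_nat !cfunE (lin_char1 lin_j) !mulr1 => ->.
Qed.

Lemma fully_ramified_pgroup p i :
  p.-group 'Z(G) -> deg i ^ 2 = #|G : 'Z(G)| -> p.-group G.
Proof.
move=> pZ sq_deg; have sZ := center_sub_cfcenter i.
have [le_deg eq_deg] := irr1_bound i.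
(* [deg i ^ 2 <= #|G : 'Z('chi_i)|] is now an equality, which is also the criterion for vanishing
   off the center. *)
have defZ : 'Z('chi_i)%CF = 'Z(G).
  apply/esym/eqP; rewrite eqEcard sZ /=.
  move: le_deg; rewrite irr1_degree -natrX ler_nat sq_deg.
  rewrite -(leq_pmul2l (cardG_gt0 'Z('chi_i)%CF)) Lagrange ?cfcenter_sub //.
  rewrite -(Lagrange (center_sub G)) leq_mul2r eqn0Ngt indexg_gt0; exact.
have off_Z x : x \in G -> x \notin 'Z(G) -> ('chi_i x = 0)%R.
  move=> Gx nZx; apply: (@cfun_on0 _ _ 'Z(G)) => //.
  by rewrite -{1}defZ -eq_deg irr1_degree -natrX sq_deg defZ.
apply/pgroupP=> q q_pr; apply: contraLR => ne_qp.
have [P sylP] := Sylow_exists q G; have [sPG qP _] := and3P sylP.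
have tiPZ : P :&: 'Z(G) = 1%g.
  apply: coprime_TIg; apply: (@pnat_coprime q); first exact: qP.
  by apply: sub_in_pnat pZ => r _; apply: contraLR => /negPn/eqnP->.
(* Only the identity of [P] contributes to the inner product with the principal character, so
   [deg i / #|P|] is a natural number. *)
have P_dvd : #|P| %| deg i.
  have Nk : '['Res[P] 'chi_i, 1]%R \in Num.nat.
    by rewrite -irr0 Cnat_cfdot_char_irr ?cfRes_char ?irr_char.
  case/natrP: Nk => k; rewrite cfdotE (bigD1 1%g) //= big1 => [|x /andP[Px nt_x]].
    rewrite addr0 cfResE // cfun1E group1 conjC1 mulr1 irr1_degree => Dk.
    apply/dvdnP; exists k; apply/eqP; rewrite -(eqr_nat algC) natrM -Dk mulrC mulVKf //.
    exact: neq0CG.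
  rewrite cfResE // off_Z ?mul0r ?(subsetP sPG) //; apply: contra nt_x => Zx.
  by rewrite -in_set1 -[[set 1%g]]tiPZ inE Px.
have oP := card_Hall sylP.
(* As [#|P|] is the full [q]-part of [#|G|], its square can divide [#|G|] only if [P] is trivial. *)
have : #|P| ^ 2 %| #|G|.
  by apply: dvdn_trans (dvdn_exp2r 2 P_dvd) _; rewrite sq_deg dvdn_indexg.
rewrite -[X in _ %| X](partnC q) // -oP Gauss_dvdl; last first.
  by rewrite coprimeXl // (pnat_coprime qP) // part_pnat.
rewrite -{2}[#|P|]muln1 expnS dvdn_pmul2l // dvdn1 expn1 oP p_part.
apply: contraL => q_dvd; rewrite neq_ltn -[X in _ || (X < _)](expn0 q).
by rewrite ltn_exp2l ?prime_gt1 // logn_gt0 mem_primes q_pr cardG_gt0 q_dvd orbT.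
Qed.

(** Central elements act as scalars, so the image of [H] modulo the kernel is cyclic as well as
    elementary abelian. *)
Lemma card_cap_cfker_center (H : {group gT}) i :
  2.-abelem H -> H \subset 'Z(G) -> #|H| <= 2 * #|H :&: cfker 'chi_i|.
Proof.
move=> abH sHZ; have nkH : H \subset 'N(cfker 'chi_i).
  by apply: subset_trans (cfker_norm _); apply: subset_trans (center_sub G).
rewrite -(Lagrange (subsetIl H (cfker 'chi_i))) mulnC leq_mul2r.
rewrite indexgI -(setIidPl nkH) -card_quotient_subnorm; apply/orP; right.
have abHk : 2.-abelem (H / cfker 'chi_i)%G by apply: quotient_abelem.
have cycHk : cyclic (H / cfker 'chi_i)%G.
  apply: cyclicS (cfcenter_cyclic 'chi_i); apply: quotientS.
  exact: subset_trans (center_sub_cfcenter i).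
have [E | ntHk] := eqVneq (H / cfker 'chi_i)%g 1%g; first by rewrite E cards1.
by rewrite (cyclic_abelem_prime abHk cycHk).
Qed.

Lemma normal_card2_center (H : {group gT}) : H <| G -> #|H| = 2 -> H \subset 'Z(G).
Proof.
move=> nsHG oH; rewrite subsetI normal_sub //=; apply/subsetP=> x Hx.
have [-> | nt_x] := eqVneq x 1%g; first exact: group1.
have /cards1P[y defH1] : #|H :\ 1%g| == 1.
  by rewrite -eqSS -add1n -oH (cardsD1 1%g H) group1.
have eq_y z : z \in H -> z != 1%g -> z = y.
  by move=> Hz nt_z; apply/set1P; rewrite -defH1 !inE nt_z.
apply/centP=> g Gg; apply/commgP/conjg_fixP.
rewrite [RHS](eq_y x) //; apply: eq_y; last by rewrite conjg_eq1.
by rewrite memJ_norm // (subsetP (normal_norm nsHG)).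
Qed.

Lemma Soc_abelem_center (p : nat) : p.-group G -> p.-abelem 'Z(G) -> Soc G = 'Z(G).
Proof.
move=> pG abZ; apply/eqP; rewrite eqEsubset; apply/andP; split.
  rewrite gen_subG; apply/bigcupsP=> M /andP[nsMG /mingroupP[/andP[ntM _] minM]].
  have ntMZ := meet_center_nil (pgroup_nil pG) nsMG ntM.
  apply/setIidPl; apply: (minM (M :&: 'Z(G))%G); last exact: subsetIl.
  by rewrite ntMZ normsI ?normal_norm ?center_normal.
apply/subsetP=> x Zx; have [-> | nt_x] := eqVneq x 1%g; first exact: group1.
have sxZ : <[x]> \subset 'Z(G) by rewrite cycle_subG.
have pr_p : prime p.
  have /(pgroup_pdiv (abelem_pgroup abZ))[] // : 'Z(G) != [1].
  by apply: contraNneq nt_x => Z1; rewrite -in_set1 -[[set 1%g]]Z1.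
have ox : #[x] = p by apply: abelem_order_p abZ Zx nt_x.
apply: (subsetP (sub_gen _) x (cycle_id x)); apply: (bigcup_max <[x]>%G) => //=.
rewrite sub_center_normal //=; apply/mingroupP; split=> [|H /andP[ntH _] sHx].
  by rewrite cycle_eq1 nt_x normal_norm // sub_center_normal.
apply/eqP; rewrite eqEcard sHx -orderE ox.
have /prime_nt_dvdP-> : #|H| %| p by rewrite -ox; apply: cardSg.
- exact: leqnn.
- exact: pr_p.
by rewrite -trivg_card1.
Qed.

(** * Minimal faithful sets *)

Lemma min_joint_ker A i : joint_ker A \subset [1] ->
  \sum_(j in A) deg j = rdim G -> i \in A -> joint_ker (A :\ i) != [1].
Proof.
move=> faithA defA Ai; apply: contraTneq (leqnn (rdim G)) => K1.
have := @rdim_le (A :\ i); rewrite K1 => /(_ (subxx _)) le_rdim.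
rewrite -ltnNge -{2}defA (big_setD1 i Ai) /=; apply: leq_ltn_trans le_rdim _.
by rewrite -[ltnLHS]add0n ltn_add2r deg_gt0.
Qed.

(** Exchange: [j |: (A :\ i)] is again faithful, so its total degree is no smaller than that of
    [A]. *)
Lemma min_deg_replace A i j : joint_ker A \subset [1] ->
    \sum_(k in A) deg k = rdim G -> i \in A ->
    joint_ker (A :\ i) :&: cfker 'chi_j \subset [1] ->
  deg i <= deg j.
Proof.
move=> faithA defA Ai; rewrite -joint_kerU1 => /rdim_le.
rewrite -defA (big_setD1 i Ai) /= => le_sum.
rewrite -(leq_add2r (\sum_(k in A :\ i) deg k)); apply: leq_trans le_sum _.
have [Aj | nAj] := boolP (j \in A :\ i); last by rewrite big_setU1.
by rewrite (setUidPr _) ?sub1set ?leq_addl.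
Qed.

(** * Groups of order [rdim G ^ 2] *)

Section Extremal.

Variables (A : {set Iirr G}) (s : nat).
Hypothesis faithA : joint_ker A \subset [1].
Hypothesis defA : \sum_(i in A) deg i = rdim G.
Hypothesis rdimG : rdim G = s.
Hypothesis oG : #|G| = s ^ 2.

Let K i : {group gT} := joint_ker_group (A :\ i).
Let nsKG i : i \in A -> K i <| G. Proof. by move=> _; apply: joint_ker_normal. Qed.
Let sKK i : i \in A -> K i \subset joint_ker (A :\ i). Proof. by []. Qed.
Let ntK i : i \in A -> K i :!=: [1]. Proof. exact: min_joint_ker. Qed.
Let E := (\prod_(i in A) K i)%G.
Let s_gt0 : 0 < s. Proof. by have := cardG_gt0 G; rewrite oG expn_gt0 orbF. Qed.

Lemma extremal_card : (forall i, i \in A -> #|K i| = 2) /\ 1 < #|A| < 5.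
Proof.
apply: (@sqrt_sum_bound _ A deg (fun i => #|K i|) s) => // [i Ai | i Ai |].
- by rewrite cardG_gt1; apply: ntK.
- by rewrite -oG; apply: indep_deg_bound; rewrite // ntK.
by rewrite defA rdimG.
Qed.

Let oK i : i \in A -> #|K i| = 2. Proof. by case: extremal_card => oK _ /oK. Qed.

Let prodK : \prod_(i in A) #|K i| = 2 ^ #|A|.
Proof. by rewrite (eq_bigr (fun=> 2) oK) prod_nat_const. Qed.

(** [K i] has prime order, so it meets a kernel not containing it trivially, and [j] can replace
    [i]. *)
Lemma extremal_min_deg i j : i \in A -> ~~ (K i \subset cfker 'chi_j) ->
  deg i <= deg j.
Proof.
move=> Ai nkK; apply: (min_deg_replace faithA defA Ai).
by rewrite prime_TIg //= oK.
Qed.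

Lemma extremal_card_neq3 : #|A| != 3.
Proof.
apply/eqP=> A3.
have le4 i : i \in A -> 4 * deg i <= s.
  move=> Ai; have [C [sCk]] := indep_sum_deg_sq faithA nsKG sKK Ai.
  rewrite prodK A3 oK // muln1 oG (bigD1 i) /=; last first.
    rewrite sCk; apply: contra (ntK Ai) => sKk.
    by rewrite -(TI_cfker_indep faithA sKK Ai) (setIidPl sKk).
  set S := \sum_(j | _) _ => oS.
  (* If ['chi_i] were the only character counted, [8 * deg i ^ 2] would be a square; the parity of
     the exponent of 2 excludes this. *)
  have [S0 | S_gt0] := posnP S.
    move: oS; rewrite S0 addn0 => /(congr1 (logn 2)).
    rewrite lognM ?expn_gt0 ?deg_gt0 // !lognX => /(congr1 odd).
    by rewrite oddD !oddM.
  have: deg i ^ 2 <= S.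
    move: S_gt0; rewrite lt0n sum_nat_eq0 negb_forall_in => /exists_inP[j].
    case/andP=> /andP[sCj nKj] ne_ji _.
    rewrite /S (bigD1 j) /= ?sCj ?nKj //; apply: leq_trans (leq_addr _ _).
    by rewrite leq_sqr extremal_min_deg.
  by move=> le_S; rewrite -leq_sqr -oS; nia.
have : 4 * s <= #|A| * s.
  by rewrite -{1}rdimG -defA big_distrr /= -sum_nat_const leq_sum.
by rewrite A3 leq_mul2r eqn0Ngt s_gt0.
Qed.

Lemma extremal_deg i : i \in A -> 2 ^ #|A| * deg i ^ 2 = s ^ 2.
Proof.
(* [c] is the square root of [2 ^ #|A|], namely 2 or 4. *)
move=> Ai; have [c [c_gt0 cA le_A]] : exists c, [/\ 0 < c, c ^ 2 = 2 ^ #|A| & #|A| <= c].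
  case: extremal_card extremal_card_neq3 => _; case: #|A| => [|[|[|[|[|n]]]]] //.
    by exists 2.
  by exists 4.
have le_d j : j \in A -> c * deg j <= s.
  move=> Aj; rewrite -leq_sqr expnMn cA mulnC.
  have := indep_deg_bound faithA nsKG sKK Aj (ntK Aj).
  by rewrite prodK oK // muln1 oG.
(* Each [c * deg j] is at most [s], but these [#|A| <= c] numbers sum to [c * s]. *)
suffices <- : c * deg i = s by rewrite expnMn cA.
apply/eqP; rewrite eqn_leq le_d //=.
have : c * s <= c * deg i + (#|A|).-1 * s.
  rewrite -{1}rdimG -defA big_distrr (big_setD1 i Ai) /= leq_add2l.
  rewrite (cardsD1 i) Ai -sum_nat_const leq_sum // => j /setD1P[_]; exact: le_d.
have : 0 < #|A| by apply/card_gt0P; exists i.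
nia.
Qed.

(** Normal subgroups of order 2 are central, so [E] lies in the center. Conversely
    [deg i ^ 2 <= #|G : 'Z(G)|] bounds [#|'Z(G)|] by [2 ^ #|A| = #|E|]. *)
Lemma extremal_center : 'Z(G) = E.
Proof.
have [oK2 /andP[A_gt1 _]] := extremal_card.
have [i Ai] : exists i, i \in A by apply/card_gt0P/ltnW.
have sEZ : E \subset 'Z(G).
  rewrite /E bigprodGE gen_subG; apply/bigcupsP=> j Aj.
  by apply: normal_card2_center (nsKG Aj) _; rewrite oK2.
apply/esym/eqP; rewrite eqEcard sEZ /= (card_indep faithA nsKG sKK) prodK.
rewrite -(leq_pmul2r (indexg_gt0 G 'Z(G))) Lagrange ?center_sub // oG -(extremal_deg Ai).
by rewrite leq_mul2l deg_sq_center orbT.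
Qed.

Lemma extremal_abelem : 2.-abelem 'Z(G) /\ #|'Z(G)| = 2 ^ #|A|.
Proof.
have oZ : #|'Z(G)| = 2 ^ #|A|.
  by rewrite extremal_center (card_indep faithA nsKG sKK).
split=> //; have abZ : 2.-abelem 'Ohm_1('Z(G)).
  by rewrite Ohm1_abelem ?center_abelian // /pgroup oZ pnatX pnat_id.
apply: abelemS abZ; suff: E \subset 'Ohm_1('Z(G)) by rewrite -extremal_center.
rewrite /E bigprodGE gen_subG; apply/bigcupsP=> i Ai.
have abK : 2.-abelem (K i) by apply: prime_abelem; rewrite ?oK.
rewrite -(Ohm1_id abK) OhmS //; apply: normal_card2_center (nsKG Ai) _.
exact: oK.
Qed.

Lemma extremal_deg_center i : i \in A -> deg i ^ 2 = #|G : 'Z(G)|.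
Proof.
move=> Ai; have [_ oZ] := extremal_abelem; apply/eqP.
rewrite -(eqn_pmul2l (cardG_gt0 'Z(G))) Lagrange ?center_sub //.
by rewrite oZ extremal_deg // oG.
Qed.

(** The [K i] generate the center, so one of them lies outside the kernel and [deg j >= deg i]. *)
Lemma extremal_fully_ramified j :
  ~~ ('Z(G) \subset cfker 'chi_j) -> deg j ^ 2 = #|G : 'Z(G)|.
Proof.
move=> nZk; apply/eqP; rewrite eqn_leq deg_sq_center /=.
have /exists_inP[i Ai nKk] : [exists i in A, ~~ (K i \subset cfker 'chi_j)].
  rewrite -negb_forall_in; apply: contra nZk => /forall_inP sKk.
  by rewrite extremal_center /E bigprodGE gen_subG; apply/bigcupsP.
by rewrite -(extremal_deg_center Ai) leq_sqr extremal_min_deg.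
Qed.

Lemma extremal_pgroup : 2.-group G.
Proof.
have [_ /andP[A_gt1 _]] := extremal_card; have [abZ _] := extremal_abelem.
have [i Ai] : exists i, i \in A by apply/card_gt0P/ltnW.
exact: fully_ramified_pgroup (abelem_pgroup abZ) (extremal_deg_center Ai).
Qed.

End Extremal.

(** * The representation dimension under full ramification *)

Lemma rdim_fully_ramified c :
    2.-group G -> 2.-abelem 'Z(G) -> #|'Z(G)| = 2 ^ c ->
    (forall j, ~~ ('Z(G) \subset cfker 'chi_j) -> deg j ^ 2 = #|G : 'Z(G)|) ->
  rdim G ^ 2 = c ^ 2 * #|G : 'Z(G)|.
Proof.
move=> pG abZ oZ ramG; have [A faithA defA] := rdim_attained.
pose N i := (joint_ker_group (A :\ i) :&: 'Z(G))%G.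
have nsNG i : i \in A -> N i <| G.
  by move=> _; rewrite normalI ?joint_ker_normal ?center_normal.
have sNK i : i \in A -> N i \subset joint_ker (A :\ i) by rewrite subsetIl.
have ntN i : i \in A -> N i :!=: [1].
  move=> Ai; apply: meet_center_nil (pgroup_nil pG) (joint_ker_normal _) _.
  exact: min_joint_ker.
have degA i : i \in A -> deg i ^ 2 = #|G : 'Z(G)|.
  move=> Ai; apply: ramG; apply: contra (ntN i Ai) => sZk.
  rewrite -(TI_cfker_indep faithA sNK Ai); apply/eqP/esym/setIidPl.
  by apply: subset_trans sZk; apply: subsetIr.
(* The nontrivial [N i] form a direct product inside the center, of order at least [2 ^ #|A|]. *)
have le_Ac : #|A| <= c.
  rewrite -(@leq_exp2l 2) // -oZ -prod_nat_const.
  apply: leq_trans (_ : \prod_(i in A) #|N i| <= _).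
    by apply: leq_prod => i Ai; rewrite cardG_gt1 ntN.
  rewrite -(card_indep faithA nsNG sNK) subset_leq_card // bigprodGE gen_subG.
  by apply/bigcupsP=> i _; apply: subsetIr.
(* Intersecting a central subgroup with one more kernel at most halves its order, and [A] cuts the
   center down to 1. *)
have le_cA : c <= #|A|.
  suffices le_Z (B : {set Iirr G}) : #|'Z(G)| <= 2 ^ #|B| * #|'Z(G) :&: joint_ker B|.
    rewrite -(@leq_exp2l 2) // -oZ -[leqRHS]muln1; apply: leq_trans (le_Z A) _.
    rewrite leq_mul2l -(cards1 (1%g : gT)) subset_leq_card ?orbT //.
    by rewrite subIset // faithA orbT.
  have [n] := ubnP #|B|; elim: n B => // n IHn B.
  have [-> _ | [i Bi]] := set_0Vmem B.
    by rewrite cards0 mul1n /joint_ker big_set0 setIT (setIidPl (center_sub G)).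
  rewrite (cardsD1 i) Bi ltnS => /IHn le_Z; apply: leq_trans le_Z _.
  rewrite expnS -mulnA mulnCA leq_mul2l; apply/orP; right.
  rewrite -(joint_kerD1I Bi) setIA.
  apply: (card_cap_cfker_center (H := ('Z(G) :&: joint_ker (B :\ i))%G)).
    exact: abelemS (subsetIl _ _) abZ.
  exact: subsetIl.
have oA : #|A| = c by apply/eqP; rewrite eqn_leq le_Ac.
have [A0 | [i Ai]] := set_0Vmem A.
  by rewrite -defA -oA A0 big_set0 cards0.
rewrite -defA (eq_bigr (fun=> deg i)).
  by rewrite sum_nat_const oA expnMn degA.
by move=> j Aj; apply/eqP; rewrite -eqn_sqr !degA.
Qed.

End FaithfulSets.

(** * Elementary abelian models and the equivalence *)

Lemma abelem_prod (p : nat) (aT rT : finGroupType) : prime p ->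
  p.-abelem [set: aT] -> p.-abelem [set: rT] -> p.-abelem [set: aT * rT].
Proof.
move=> pr_p /(abelemP pr_p)[cAA exA] /(abelemP pr_p)[cRR exR].
have expg_pair (u : aT * rT) n : (u ^+ n = (u.1 ^+ n, u.2 ^+ n))%g.
  by elim: n => // n IHn; rewrite !expgS IHn.
apply/abelemP=> //; split=> [|u _]; last by rewrite expg_pair exA ?exR ?inE.
apply/centsP=> u _ v _; congr (_, _).
  by apply: (centsP cAA); rewrite inE.
by apply: (centsP cRR); rewrite inE.
Qed.

Lemma abelem_Z2 : 2.-abelem [set: 'Z_2].
Proof. by apply: prime_abelem; rewrite // cardsT card_ord. Qed.

Theorem theoremB (gT : finGroupType) (G : {group gT}) (ntG : G :!=: 1) :
  ((rdim G)%:R = sqrtC (#|G|%:R) :> algC)%R <->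
  [/\ 2.-group G, Soc G = 'Z(G), 'Z(G) \isog [set: 'Z_2 * 'Z_2]
    & forall i : Iirr G, Irr_center i -> fully_ramified 'Z(G) i]
  \/
  [/\ 2.-group G, Soc G = 'Z(G), 'Z(G) \isog [set: 'Z_2 * 'Z_2 * 'Z_2 * 'Z_2]
    & forall i : Iirr G, Irr_center i -> fully_ramified 'Z(G) i].
Proof.
have ab2 : 2.-abelem [set: 'Z_2 * 'Z_2] by rewrite !abelem_prod ?abelem_Z2.
have ab4 : 2.-abelem [set: 'Z_2 * 'Z_2 * 'Z_2 * 'Z_2].
  by rewrite !abelem_prod ?abelem_Z2.
have o2 : #|[set: 'Z_2 * 'Z_2]| = (2 ^ 2)%N by rewrite cardsT !card_prod !card_ord.
have o4 : #|[set: 'Z_2 * 'Z_2 * 'Z_2 * 'Z_2]| = (2 ^ 4)%N.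
  by rewrite cardsT !card_prod !card_ord.
have rdimE : ((rdim G)%:R = sqrtC #|G|%:R :> algC)%R <-> #|G| = (rdim G ^ 2)%N.
  split=> [Dr | ->]; last by rewrite natrX sqrCK ?ler0n.
  by apply/eqP; rewrite -(eqr_nat algC) natrX Dr sqrtCK.
rewrite rdimE; split=> [oG | ].
  have [A faithA defA] := rdim_attained G.
  have [abZ oZ] := extremal_abelem faithA defA erefl oG.
  have pG := extremal_pgroup faithA defA erefl oG.
  have SocG := Soc_abelem_center pG abZ.
  have ramG (i : Iirr G) : Irr_center i -> fully_ramified 'Z(G) i.
    by move/Irr_centerP/(extremal_fully_ramified faithA defA erefl oG)/fully_ramifiedP.
  have [_] := extremal_card faithA defA erefl oG.
  have := extremal_card_neq3 faithA defA erefl oG.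
  case: #|A| oZ => [|[|[|[|[|n]]]]] // oZ _ _; [left | right]; split=> //.
    by rewrite (isog_abelem_card _ abZ) ab2 o2 oZ /=.
  by rewrite (isog_abelem_card _ abZ) ab4 o4 oZ /=.
(* Ranks 2 and 4 satisfy [c ^ 2 = 2 ^ c], which turns [c ^ 2 * #|G : 'Z(G)|] into [#|G|]. *)
have rdimG c : (c ^ 2 = 2 ^ c)%N ->
    2.-group G -> 2.-abelem 'Z(G) -> #|'Z(G)| = (2 ^ c)%N ->
    (forall i : Iirr G, Irr_center i -> fully_ramified 'Z(G) i) ->
  #|G| = (rdim G ^ 2)%N.
  move=> cE pG abZ oZ ramG; rewrite (rdim_fully_ramified pG abZ oZ).
    by rewrite cE -oZ Lagrange ?center_sub.
  by move=> j /Irr_centerP/ramG/fully_ramifiedP.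
case=> [] [pG _ isoZ ramG].
  by apply: (rdimG 2); rewrite ?(isog_abelem isoZ) ?(card_isog isoZ).
by apply: (rdimG 4); rewrite ?(isog_abelem isoZ) ?(card_isog isoZ).
Qed.
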